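(* Let $s>t>0$, $R>0$ and $\eta\in(0,1)$. There are $C_\eta>0$ and $N_\eta\in\mathbb{N}$ such that for every $n\geq N_\eta$ with $J:=\left\lfloor \frac{1}{2t+1/2}\frac{\ln(n)}{\ln(2)}\right\rfloor\ge 2$ and every $\rho>0$ with $$\rho\leq C_{\eta}n^{-\frac{t}{2t+1/2}},$$ for any test $\varphi$ it holds that $$\sup_{f\in B_s(R)}\mathbb{P}_f(\varphi=1)+\sup_{f\in \widetilde{B}_{s,t}(R,\rho)}\mathbb{P}_f(\varphi=0)>\eta.$$ Hence, for such $n$, $$\rho^\ast(\eta)\geq C_{\eta}n^{-\frac{t}{2t+1/2}},$$ i.e. $\rho^\ast(\eta)\gtrsim n^{-\frac{t}{2t+1/2}}$ (inequality up to a positive constant not depending on $n$). In particular, one may choose $$C_\eta:=\frac{R}{2}\min\left\{1,\frac{\sqrt{\ln(1+4(1-\eta)^2)}}{2^t\, 16R}\right\},\qquad N_\eta:=\left\lceil \left(R\,\frac{2^{s-t}}{C_\eta}\right)^{\frac{2t+1/2}{s-t}}\right\rceil.$$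
   Context: Function space and wavelet basis. $L_2=L_2([0,1])$ with scalar product $\langle g,h\rangle=\int_0^1 g(x)h(x)\,\mathrm{d}x$ and norm $\Vert\cdot\Vert_{L_2}$. Fix an orthonormal wavelet basis of $L_2$ of the form $\{\psi_{j,k}: j\ge 2,\ k\in\{1,\dots,2^j\}\}$ (exactly $2^j$ basis functions at resolution $j\ge 2$). For $r>0$ and $g\in L_2$ let $$\Vert g\Vert_{\mathcal{B}_r}=\sqrt{\sum_{j=2}^\infty 4^{jr}\sum_{k=1}^{2^j}\langle g,\psi_{j,k}\rangle^2},\qquad B_r(R)=\{g\in L_2:\Vert g\Vert_{\mathcal{B}_r}\le R\}.$$ For $\rho>0$ let $$\widetilde{B}_{s,t}(R,\rho)=\left\{g\in B_t(R):\ \inf_{h\in B_s(R)}\Vert g-h\Vert_{L_2}>\rho\right\}.$$ Observation. For $n\ge1$ and an unknown fixed $f\in L_2$ one observes $(Y(x))_{x\in[0,1]}$ with $\mathrm{d}Y(x)=f(x)\,\mathrm{d}x+\frac{1}{\sqrt n}\,\mathrm{d}B(x)$, where $B$ is a standard Brownian motion; $\mathbb{P}_f$ is the resulting probability measure. Equivalently, one observes the independent family $\widehat a_{j,k}=\langle \mathrm{d}Y,\psi_{j,k}\rangle\sim\mathcal{N}(\langle f,\psi_{j,k}\rangle,\frac1n)$, $j\ge2$, $1\le k\le 2^j$. A test is a measurable $\{0,1\}$-valued function of the observation. Minimax separation distance (depending on $n$, $s$, $t$, $R$, $\eta$). $$\rho^\ast(\eta)=\inf\left\{\rho>0:\ \exists\text{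 test }\varphi:\ \sup_{f\in B_s(R)}\mathbb{P}_f(\varphi=1)+\sup_{f\in \widetilde{B}_{s,t}(R,\rho)}\mathbb{P}_f(\varphi=0)\leq\eta\right\}.$$ *)

(* Defs.v *)
From HB Require Import structures.
From mathcomp Require Import all_boot all_order all_algebra.
From mathcomp Require Import all_classical all_reals all_analysis.

Set Implicit Arguments.
Unset Strict Implicit.
Unset Printing Implicit Defensive.

Import Order.TTheory GRing.Theory Num.Theory.
Import numFieldNormedType.Exports.

Local Open Scope classical_set_scope.
Local Open Scope ring_scope.

Section function_space.
Variable R : realType.
Implicit Types (g h : R -> R) (psi : nat -> nat -> R -> R).

Definition unit_lebesgue : {measure set (measurableTypeR R) -> \bar R} :=
  mrestr lebesgue_measure
    (measurable_itv `[0, 1] : measurable (`[0, 1] : set (measurableTypeR R))).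

(* Elements of L2([0,1]) are represented by functions on the whole line; every
   notion below depends only on their classes modulo a.e. equality on [0,1]. *)
Definition L2 : set (R -> R) := [set g | g \in Lfun unit_lebesgue 2%:E].

Definition L2norm g : \bar R := 'N[unit_lebesgue]_2%:E[EFin \o g].

Definition L2inner g h : R := \int[unit_lebesgue]_x (g x * h x).

Definition wavelet_index : Type :=
  {jk : nat * nat | (2 <= jk.1)%N && (1 <= jk.2 <= 2 ^ jk.1)%N}.

(* Only the values psi j k with (j, k) a wavelet_index matter. *)
Definition wavelet psi (i : wavelet_index) : R -> R :=
  psi (val i).1 (val i).2.

Definition orthonormal_basis psi : Prop :=
  [/\ forall i, L2 (wavelet psi i),
      forall i i', L2inner (wavelet psi i) (wavelet psi i') = (i == i')%:R
    & forall g, L2 g -> forall e : R, 0 < e ->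
        exists (m : nat) (c : nat -> nat -> R),
          (L2norm (fun x => g x - \sum_(2 <= j < m)
             \sum_(1 <= k < (2 ^ j).+1) c j k * psi j k x)%R < e%:E)%E].

Definition besov_norm psi (r : R) g : \bar R :=
  sqrte (\sum_(2 <= j <oo)
    ((4 `^ (j%:R * r))%:E *
     \sum_(1 <= k < (2 ^ j).+1) (L2inner g (psi j k) ^+ 2)%:E))%E.

Definition besov_ball psi (r rad : R) : set (R -> R) :=
  [set g | L2 g /\ (besov_norm psi r g <= rad%:E)%E].

Definition separated_ball psi (s t rad rho : R) : set (R -> R) :=
  [set g | besov_ball psi t rad g /\
    (rho%:E < ereal_inf [set L2norm (g \- h)%R | h in besov_ball psi s rad])%E].

End function_space.

(* The observation is the family of noisy coefficients; a measurable function
   of the observation is one that is measurable for the product sigma-algebra,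
   generated by the coordinates. *)
Definition observation (R : realType) :=
  g_sigma_algebraType
    (\bigcup_(i in [set: wavelet_index])
      preimage_set_system setT (fun a : wavelet_index -> R => a i)
        (@measurable _ (measurableTypeR R))).

Section testing.
Variable R : realType.
Implicit Types (psi : nat -> nat -> R -> R)
  (P : (R -> R) -> probability (observation R) R).

Definition independent_coordinates (Q : probability (observation R) R) : Prop :=
  forall (I : seq wavelet_index) (B : wavelet_index -> set (measurableTypeR R)),
    uniq I -> (forall i, measurable (B i)) ->
    Q [set a : observation R | forall i, i \in I -> B i (a i)] =
    (\prod_(i <- I) Q [set a : observation R | B i (a i)])%E.

(* normal_prob takes the standard deviation, here n^(-1/2). The conditions
   determine P f uniquely on the product sigma-algebra. *)
Definition white_noise_model psi (n : nat) P : Prop :=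
  forall f, L2 f ->
    independent_coordinates (P f) /\
    forall i (B : set (measurableTypeR R)), measurable B ->
      P f [set a : observation R | B (a i)] =
      normal_prob (L2inner f (wavelet psi i)) (Num.sqrt n%:R)^-1 B.

(* The supremum is the one of real numbers, applied to subsets of [0, 1]; it is
   0 on the empty set, as fits an empty alternative. *)
Definition total_error P (H0 H1 : set (R -> R))
    (phi : {mfun observation R >-> bool}) : R :=
  sup [set fine (P f (phi @^-1` [set true])) | f in H0] +
  sup [set fine (P f (phi @^-1` [set false])) | f in H1].

Definition separation_distance psi P (s t rad eta : R) : \bar R :=
  ereal_inf [set rho%:E | rho in [set rho : R | 0 < rho /\
    exists phi : {mfun observation R >-> bool},
      total_error P (besov_ball psi s rad) (separated_ball psi s t rad rho) phi
        <= eta]].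

End testing.

(* Main.v *)
Require Import Defs.
From HB Require Import structures.
From mathcomp Require Import all_boot all_order all_algebra.
From mathcomp Require Import all_classical all_reals all_analysis.
From mathcomp Require Import measurable_realfun ring lra.
Import Order.TTheory GRing.Theory Num.Theory.
Import numFieldNormedType.Exports.
Local Open Scope classical_set_scope.
Local Open Scope ring_scope.

Set Implicit Arguments.
Unset Strict Implicit.
Unset Printing Implicit Defensive.

(** The proof randomizes over a hypercube of alternatives living on a single
    resolution level J, the integer part of log_2 n / (2 t + 1/2), so that
    2^J is of the order n^(1/(2t+1/2)).

    For signs xi in {-1, 1}^(2^J) let f_xi = alpha * sum_k xi_k psi_(J,k), with
    alpha chosen so that the L2 norm 2^(J/2) alpha is D = 2 C 2^(-Jt).
    - f_xi lies in the t-ball: its Besov norm is 2^(Jt) D = 2 C <= rad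
      ([besov_norm_level_fun], [besov_weight]).
    - f_xi is separated from the s-ball: the level-J part of an element of that
      ball has norm at most rad 2^(-Js), so the distance is at least
      D - rad 2^(-Js) ([level_fun_separated]); the condition n >= N gives
      rad 2^(-Js) < C 2^(-Jt) ([smooth_bias_lt]), which leaves more than
      C 2^(-Jt) >= C n^(-t/(2t+1/2)) >= rho.
    - f_xi cannot be told apart from 0, averaged over xi. By independence the
      likelihood of P_(f_xi) relative to P_0 is a product over the level-J
      coordinates of Gaussian tilts ([gaussian_likelihood]). Averaging a
      product over independent signs gives the product of the averages
      ([mixture_likelihoodE]), hence a mixture likelihood H with
      E_0 H = 1 and E_0 H^2 = cosh(n alpha^2)^(2^J)
      ([mixture_second_moment]). The choice of J and C makes this second moment
      smaller than 1 + 4 (1 - eta)^2 ([level_separation_budget],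
      [chi_square_budget]).

    The total variation distance between P_0 and the mixture is at most half
    the square root of E_0 H^2 - 1, hence smaller than 1 - eta; so every
    test accepts the null hypothesis too often under some f_xi
    ([sign_fun_indistinguishable]).

    The measures P_f are only known through the laws of finitely many
    coordinates.  Expectations of products over coordinates
    ([expectation_prod]) and the identity between P_(f_xi) and its density on
    the whole product sigma-algebra ([cylinder_measure_unique]) are derived
    from these. *)

(** * Measures with a density *)

Section density_measure.
Local Open Scope ereal_scope.
Context d (T : measurableType d) (R : realType).
Variables (mu : {measure set T -> \bar R}) (f : T -> R).
Hypotheses (mf : measurable_fun [set: T] f) (f0 : forall x, (0 <= f x)%R).

(** The proofs that f is measurable and nonnegative are arguments, because the
    measure structure is attached to this set function and depends on them. *)
Definition density_measure (_ : measurable_fun [set: T] f)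
    (_ : forall x, (0 <= f x)%R) (A : set T) : \bar R :=
  \int[mu]_(x in A) (f x)%:E.

Local Notation nu := (density_measure mf f0).

Let nu0 : nu set0 = 0. Proof. exact: integral_set0. Qed.

Let nu_ge0 A : 0 <= nu A.
Proof. by apply: integral_ge0 => x _; rewrite lee_fin. Qed.

Let nu_sigma_additive : semi_sigma_additive nu.
Proof.
move=> F mF tF mUF; rewrite /density_measure ge0_integral_bigcup//.
- by apply: is_cvg_ereal_nneg_natsum_cond => n _ _; exact: nu_ge0.
- exact/measurable_EFinP/measurable_funTS.
- by move=> x _; rewrite lee_fin.
Qed.

HB.instance Definition _ := isMeasure.Build _ _ _ nu
  nu0 nu_ge0 nu_sigma_additive.

Import HBNNSimple.

Let integral_density_indic A : measurable A ->
  \int[nu]_x (\1_A x)%:E = \int[mu]_x ((\1_A x)%:E * (f x)%:E).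
Proof.
move=> mA; rewrite integral_indic// setIT.
rewrite [LHS](_ : _ = \int[mu]_(x in A) (f x)%:E)// integral_mkcond.
by apply: eq_integral => x _; rewrite epatch_indic muleC.
Qed.

Let integral_density_nnsfun (h : {nnsfun T >-> R}) :
  \int[nu]_x (h x)%:E = \int[mu]_x ((h x)%:E * (f x)%:E).
Proof.
under [LHS]eq_integral do rewrite fimfunE -fsumEFin//.
rewrite [LHS]ge0_integral_fsum//; last 2 first.
  - by move=> r; exact/measurable_EFinP/measurableT_comp.
  - by move=> n x _; rewrite EFinM nnfun_muleindic_ge0.
under [RHS]eq_integral.
  move=> x _; rewrite fimfunE -fsumEFin// ge0_mule_fsuml; last first.
    by move=> r; rewrite EFinM nnfun_muleindic_ge0.
  over.
rewrite [RHS]ge0_integral_fsum//; last 2 first.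
  - move=> r; apply: emeasurable_funM; last exact/measurable_EFinP.
    exact/measurable_EFinP/measurableT_comp.
  - move=> n x _; rewrite mule_ge0 ?lee_fin// -lee_fin EFinM.
    exact: nnfun_muleindic_ge0.
apply: eq_fsbigr => r _.
have [r0|r0] := ltP r 0%R.
  rewrite preimage_nnfun0// !integral0_eq// => x _;
    by rewrite indic0 mulr0 ?mul0e.
under [LHS]eq_integral do rewrite EFinM.
under [RHS]eq_integral do rewrite EFinM -muleA.
rewrite ge0_integralZl_EFin//; last exact/measurable_EFinP.
rewrite ge0_integralZl_EFin ?integral_density_indic//.
- by move=> x _; rewrite mule_ge0// lee_fin.
- by apply: emeasurable_funM; exact/measurable_EFinP.
Qed.

(** The change of measure formula extends from indicators to simple functions
    by linearity and to nonnegative functions by monotone convergence. *)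
Lemma ge0_integral_density (g : T -> \bar R) :
  measurable_fun [set: T] g -> (forall x, 0 <= g x) ->
  \int[nu]_x g x = \int[mu]_x (g x * (f x)%:E).
Proof.
move=> mg g0; pose g_ := nnsfun_approx measurableT mg.
have cvgg x : (g_ n x)%:E @[n --> \oo] --> g x.
  by apply: cvg_nnsfun_approx => //.
transitivity (limn (fun n => \int[nu]_x (g_ n x)%:E)).
  rewrite -monotone_convergence//=.
  - by apply: eq_integral => x _; exact/esym/cvg_lim.
  - by move=> n; exact/measurable_EFinP.
  - by move=> n x _; rewrite lee_fin.
  - by move=> x _ a b ab; rewrite lee_fin; exact/lefP/nd_nnsfun_approx.
transitivity (limn (fun n => \int[mu]_x ((g_ n x)%:E * (f x)%:E))).
  by congr (limn _); apply/funext => n; rewrite integral_density_nnsfun.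
rewrite -monotone_convergence//=.
- apply: eq_integral => x _; under eq_fun do rewrite muleC.
  rewrite limeMl ?(muleC (f x)%:E)//; last by apply/cvg_ex; exists (g x).
  by congr (_ * _); exact/cvg_lim.
- by move=> n; apply: emeasurable_funM; exact/measurable_EFinP.
- by move=> n x _; rewrite mule_ge0// lee_fin.
- move=> x _ a b ab; rewrite lee_wpmul2r ?lee_fin//.
  exact/lefP/nd_nnsfun_approx.
Qed.

End density_measure.

(** * Cylinders of the product space *)

Section cylinders.
Context {R : realType}.
Implicit Types (S : seq wavelet_index)
  (B : wavelet_index -> set (measurableTypeR R)).

Lemma measurable_coordinate i :
  measurable_fun [set: observation R]
    (fun a : observation R => a i : measurableTypeR R).
Proof.
by move=> _ A mA; apply: sub_sigma_algebra; exists i => //; exists A.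
Qed.

Definition cylinder S B : set (observation R) :=
  [set a | forall i, i \in S -> B i (a i)].

Definition cylinders : set (set (observation R)) :=
  [set A | exists S B, (forall i, measurable (B i)) /\ A = cylinder S B].

Lemma measurable_cylinder S B :
  (forall i, measurable (B i)) -> measurable (cylinder S B).
Proof.
move=> mB; elim: S => [|i S IH].
  rewrite (_ : cylinder _ _ = setT); first exact: measurableT.
  by apply/seteqP; split.
rewrite (_ : cylinder _ _ =
    (fun a : observation R => a i) @^-1` (B i) `&` cylinder S B).
  apply: measurableI => //; rewrite -[X in measurable X]setTI.
  exact: measurable_coordinate.
apply/seteqP; split=> [a aB|a [aBi aB] j].
  split; first by apply: aB; rewrite mem_head.
  by move=> j jS; apply: aB; rewrite in_cons jS orbT.
by rewrite in_cons => /orP[/eqP->//|]; exact: aB.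
Qed.

Lemma measurable_guard (b : bool) (A : set (measurableTypeR R)) :
  measurable A -> measurable [set x : measurableTypeR R | b -> A x].
Proof.
case: b => mA.
  by rewrite (_ : [set _ | _] = A)//; apply/seteqP; split=> x /= => [/(_ isT)|].
by rewrite (_ : [set _ | _] = setT)//; apply/seteqP; split.
Qed.

(** Two cylinders can thus be written over the same list of coordinates, by
    leaving the additional coordinates unconstrained. *)
Lemma cylinder_widen S S' B : {subset S <= S'} ->
  cylinder S B = cylinder S' (fun i => [set x | i \in S -> B i x]).
Proof.
move=> SS'; apply/seteqP; split=> a aB i iS; first exact: aB.
by apply: aB => //; exact: SS'.
Qed.

Lemma setI_closed_cylinders : setI_closed cylinders.
Proof.
move=> _ _ [S1 [B1 [mB1 ->]]] [S2 [B2 [mB2 ->]]].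
have sub1 : {subset S1 <= S1 ++ S2} by move=> i iS; rewrite mem_cat iS.
have sub2 : {subset S2 <= S1 ++ S2} by move=> i iS; rewrite mem_cat iS orbT.
exists (S1 ++ S2).
exists (fun i => [set x : measurableTypeR R | i \in S1 -> B1 i x] `&`
                 [set x : measurableTypeR R | i \in S2 -> B2 i x]).
split; first by move=> i; apply: measurableI; exact: measurable_guard.
rewrite (cylinder_widen B1 sub1) (cylinder_widen B2 sub2).
apply/seteqP; split=> [a [aB1 aB2] i iS|a aB].
  by split; [exact: aB1|exact: aB2].
by split=> i iS; have [] := aB i iS.
Qed.

Lemma measurable_cylindersE :
  @measurable _ (observation R) = <<s cylinders >>.
Proof.
apply/seteqP; split; last first.
  apply: smallest_sub; first exact: sigma_algebra_measurable.
  by move=> _ [S [B [mB ->]]]; exact: measurable_cylinder.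
apply: smallest_sub; first exact: smallest_sigma_algebra.
move=> A [i _ [B mB <-]]; apply: sub_sigma_algebra.
exists [:: i], (fun=> B); split=> //.
apply/seteqP; split=> [a [_ aB] j|a aB]; first by rewrite inE => /eqP->.
by split=> //; apply: aB; rewrite inE.
Qed.

(** Cylinders are stable by intersection and generate the sigma-algebra, so
    Dynkin's uniqueness theorem applies. *)
Lemma cylinder_measure_unique
    (mu nu : {measure set (observation R) -> \bar R}) :
  (mu setT < +oo)%E ->
  (forall S B, (forall i, measurable (B i)) ->
    mu (cylinder S B) = nu (cylinder S B)) ->
  forall A, measurable A -> mu A = nu A.
Proof.
move=> muT munu A mA; apply: (measure_unique cylinders (fun=> setT)) => //.
- exact: measurable_cylindersE.
- exact: setI_closed_cylinders.
- move=> _; exists [::], (fun=> setT); split=> //.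
  by apply/seteqP; split.
- by rewrite bigcup_const.
- by move=> _ [S [B [mB ->]]]; exact: munu.
Qed.

End cylinders.

(** * Expectation of a product over independent coordinates *)

Section independence.
Local Open Scope ereal_scope.

(** The hypothesis says that the image by X of the measure F.mu is c times the
    image of mu; integrating g against both images gives the conclusion. *)
Lemma ge0_integral_uncorrelated d d' (T : measurableType d)
    (T' : measurableType d') (R : realType) (mu : {measure set T -> \bar R})
    (X : T -> T') (F : T -> R) (c : R) (g : T' -> R) :
  measurable_fun [set: T] X ->
  measurable_fun [set: T] F -> (forall x, (0 <= F x)%R) -> (0 <= c)%R ->
  (forall A, measurable A ->
    \int[mu]_(x in X @^-1` A) (F x)%:E = c%:E * mu (X @^-1` A)) ->
  measurable_fun [set: T'] g -> (forall x, (0 <= g x)%R) ->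
  \int[mu]_x (g (X x) * F x)%:E = c%:E * \int[mu]_x (g (X x))%:E.
Proof.
move=> mX mF F0 c0 FE mg g0.
have mgE : measurable_fun [set: T'] (EFin \o g) by exact/measurable_EFinP.
have mgX : measurable_fun [set: T] (fun x => (g (X x))%:E).
  exact/measurable_EFinP/measurableT_comp.
have gX0 x : 0 <= (g (X x))%:E by rewrite lee_fin.
have lawE (h : T -> R) (mh : measurable_fun [set: T] h)
    (h0 : forall x, (0 <= h x)%R) :
    \int[pushforward (density_measure mu mh h0) X]_y (g y)%:E =
    \int[mu]_x ((g (X x))%:E * (h x)%:E).
  rewrite ge0_integral_pushforward//; last by move=> y _; rewrite lee_fin.
  by rewrite preimage_setT ge0_integral_density.
have mc : measurable_fun [set: T] (cst c) by [].
transitivity (\int[pushforward (density_measure mu mF F0) X]_y (g y)%:E).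
  by rewrite lawE; apply: eq_integral => x _; rewrite EFinM.
transitivity (\int[pushforward (density_measure mu mc (fun=> c0)) X]_y
    (g y)%:E).
  apply: eq_measure_integral => A mA _; rewrite [LHS]FE//.
  rewrite [RHS](_ : _ = \int[mu]_(x in X @^-1` A) c%:E)// integral_cst//.
  rewrite -[X in measurable X]setTI; exact: mX.
rewrite lawE -ge0_integralZl_EFin//.
by apply: eq_integral => x _; rewrite muleC.
Qed.

Context {R : realType}.

Variables (Q : probability (observation R) R).
Hypothesis Qindep : independent_coordinates Q.
Variable g : wavelet_index -> R -> R.
Hypothesis mg : forall i, measurable_fun [set: measurableTypeR R] (g i).
Hypothesis g0 : forall i x, (0 <= g i x)%R.

Lemma measurable_prod_coordinates (I : seq wavelet_index) :
  measurable_fun [set: observation R]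
    (fun a : observation R => \prod_(i <- I) g i (a i))%R.
Proof.
apply: measurable_prod => i _.
exact: (measurableT_comp (mg i) (measurable_coordinate i)).
Qed.

(** The functions g i are introduced one at a time: the statement for the
    coordinates in I, applied to all events on one further coordinate i (moved
    to K), says that the factor at i is uncorrelated with the product over I
    and the event on K, which [ge0_integral_uncorrelated] extends from events
    to g i. *)
Let expectation_prod_cylinder (I K : seq wavelet_index)
    (B : wavelet_index -> set (measurableTypeR R)) :
  uniq (I ++ K) -> (forall i, measurable (B i)) ->
  (forall i, i \in I -> \int[Q]_a (g i (a i))%:E < +oo) ->
  \int[Q]_(a in cylinder K B) (\prod_(i <- I) g i (a i))%:E =
  (\prod_(i <- I) \int[Q]_a (g i (a i))%:E) *
  \prod_(i <- K) Q [set a | B i (a i)].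
Proof.
elim: I K B => [|i I IH] K B /=.
  move=> uK mB _; under eq_integral do rewrite big_nil.
  rewrite integral_cst ?mul1e ?big_nil ?mul1e; last exact: measurable_cylinder.
  exact: Qindep.
move=> /andP[iIK uIK] mB fin_g.
have [iI iK] : i \notin I /\ i \notin K.
  by move: iIK; rewrite mem_cat negb_or => /andP.
have fin_gI j : j \in I -> \int[Q]_a (g j (a j))%:E < +oo.
  by move=> jI; apply: fin_g; rewrite in_cons jI orbT.
pose P (J : seq wavelet_index) (a : observation R) :=
  (\prod_(j <- J) g j (a j))%R.
have mP J : measurable_fun [set: observation R] (P J).
  exact: measurable_prod_coordinates.
have P0 J a : (0 <= P J a)%R by rewrite /P; apply: prodr_ge0 => j _; exact: g0.
have mK := measurable_cylinder K mB.
pose F a := (P I a * \1_(cylinder K B) a)%R.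
have mF : measurable_fun [set: observation R] F.
  by apply: measurable_funM => //; exact: measurable_indic.
have F0 a : (0 <= F a)%R by rewrite mulr_ge0.
have mQB j : measurable [set a : observation R | B j (a j)].
  by rewrite -[X in measurable X]setTI; exact: measurable_coordinate.
have int_g0 j : 0 <= \int[Q]_a (g j (a j))%:E.
  by apply: integral_ge0 => a _; rewrite lee_fin.
pose c := (\prod_(j <- I) \int[Q]_a (g j (a j))%:E) *
  \prod_(j <- K) Q [set a | B j (a j)].
have cfin : c \is a fin_num.
  rewrite /c fin_numM//; last first.
    apply: (big_ind (fun x => x \is a fin_num)) => // [x y xf yf|j _].
      by rewrite fin_numM.
    by apply: fin_num_measure; exact: mQB.
  rewrite big_seq.
  apply: (big_ind (fun x => x \is a fin_num)) => // [x y xf yf|j jI].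
    by rewrite fin_numM.
  by rewrite ge0_fin_numE// fin_gI.
have c0 : 0 <= c.
  rewrite mule_ge0//; apply: (big_ind (fun x => 0 <= x)) => // x y x0 y0;
    exact: mule_ge0.
have restrE A f : measurable A ->
    \int[Q]_(a in A) (f a)%:E = \int[Q]_a (f a * \1_A a)%:E.
  move=> mA; rewrite integral_mkcond; apply: eq_integral => a _.
  by rewrite epatch_indic EFinM.
rewrite restrE// big_cons -muleA -/c -(fineK cfin) muleC.
rewrite -(@ge0_integral_uncorrelated _ _ _ _ _ _
  (fun a : observation R => a i : measurableTypeR R) F)//.
- by apply: eq_integral => a _; rewrite /F /P big_cons mulrA.
- exact: measurable_coordinate.
- by rewrite fine_ge0.
- move=> A mA; rewrite fineK//.
  pose B' j := if j == i then A else B j.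
  have mB' j : measurable (B' j) by rewrite /B'; case: ifP.
  have B'K j : j \in K -> B' j = B j.
    by rewrite /B'; case: eqP => // ->; rewrite (negPf iK).
  rewrite restrE; last first.
    by rewrite -[X in measurable X]setTI; exact: measurable_coordinate.
  transitivity (\int[Q]_(a in cylinder (i :: K) B') (P I a)%:E).
    rewrite [RHS]restrE; last exact: measurable_cylinder.
    apply: eq_integral => a _; congr EFin; rewrite /F -mulrA; congr (_ * _)%R.
    rewrite -[LHS]/((\1_(cylinder K B) \*
      \1_((fun x : observation R => x i) @^-1` A)) a)%R.
    rewrite -indicI; congr (\1_ _ _); apply/seteqP; split=> [x [xB xA] j|x xB].
      rewrite in_cons => /orP[/eqP->|jK]; first by rewrite /B' eqxx.
      by rewrite B'K//; exact: xB.
    split; last by have := xB i (mem_head _ _); rewrite /B' eqxx.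
    by move=> j jK; rewrite -B'K//; apply: (xB j); rewrite in_cons jK orbT.
  rewrite IH//; last first.
    rewrite -cat_rcons -cats1 -catA cat1s uniq_catC /= uniq_catC.
    by rewrite mem_cat negb_or iK iI.
  rewrite big_cons muleCA muleC; congr (_ * _); last by rewrite /B' eqxx.
  rewrite /c; congr (_ * _); rewrite big_seq [RHS]big_seq.
  by apply: eq_bigr => j jK; rewrite B'K.
Qed.

Lemma expectation_prod (I : seq wavelet_index) :
  uniq I -> (forall i, i \in I -> \int[Q]_a (g i (a i))%:E < +oo) ->
  \int[Q]_a (\prod_(i <- I) g i (a i))%:E =
  \prod_(i <- I) \int[Q]_a (g i (a i))%:E.
Proof.
move=> uI fin_g.
have := @expectation_prod_cylinder I [::] (fun=> setT).
rewrite cats0 big_nil mule1 => <-//.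
by congr (integral _ _ _); apply/seteqP; split.
Qed.

End independence.

(** * Tilting Gaussian coordinates *)

Section gaussian_tilt.
Context {R : realType}.
Variable v : R.
Hypothesis v0 : 0 < v.
Local Notation sigma := ((Num.sqrt v)^-1).

(** The likelihood ratio of N(m, 1/v) with respect to N(0, 1/v). *)
Definition tilt (m x : R) : R := expR (v * m * x - v * m ^+ 2 / 2).

Lemma tilt_ge0 m x : 0 <= tilt m x. Proof. exact: expR_ge0. Qed.

Lemma tilt0 x : tilt 0 x = 1.
Proof. by rewrite /tilt expr0n/= !(mulr0, mul0r) subrr expR0. Qed.

Lemma measurable_tilt m : measurable_fun [set: measurableTypeR R] (tilt m).
Proof.
by apply: measurableT_comp => //; exact: measurable_funB.
Qed.

Lemma tilt_sqr m x : tilt m x ^+ 2 = expR (v * m ^+ 2) * tilt (2 * m) x.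
Proof. by rewrite /tilt -expRM_natl -expRD; congr expR; field. Qed.

Lemma tilt_mulN m x : tilt m x * tilt (- m) x = expR (- (v * m ^+ 2)).
Proof. by rewrite /tilt -expRD; congr expR; field. Qed.

Lemma normal_pdf_tilt m x :
  normal_pdf m sigma x = tilt m x * normal_pdf 0 sigma x.
Proof.
have s0 : sigma != 0 by rewrite invr_eq0 gt_eqF// sqrtr_gt0.
have s2 : sigma ^+ 2 = v^-1 by rewrite exprVn sqr_sqrtr// ltW.
rewrite !normal_pdfE// mulrCA; congr (_ * _).
rewrite /normal_fun /tilt -expRD s2; congr expR; field.
exact: lt0r_neq0.
Qed.

End gaussian_tilt.

Section gaussian_coordinates.
Context {R : realType}.
Variable v : R.
Hypothesis v0 : 0 < v.
Local Notation sigma := ((Num.sqrt v)^-1).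
Local Open Scope ereal_scope.

Definition gaussian_coordinates (Q : probability (observation R) R)
    (m : wavelet_index -> R) : Prop :=
  independent_coordinates Q /\
  forall i (B : set (measurableTypeR R)), measurable B ->
    Q [set a : observation R | B (a i)] = normal_prob (m i) sigma B.

Lemma gaussian_coordinate_integral (Q : probability (observation R) R) m i
    (g : R -> R) : gaussian_coordinates Q m ->
  measurable_fun [set: measurableTypeR R] g -> (forall x, (0 <= g x)%R) ->
  \int[Q]_a (g (a i))%:E =
  \int[lebesgue_measure]_x (g x * normal_pdf (m i) sigma x)%:E.
Proof.
move=> [_ law] mg g0; have mi := @measurable_coordinate R i.
have gE0 (x : R) : 0 <= (g x)%:E by rewrite lee_fin.
have mgE : measurable_fun [set: measurableTypeR R] (EFin \o g).
  exact/measurable_EFinP.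
transitivity (\int[pushforward Q
    (fun a : observation R => a i : measurableTypeR R)]_y (g y)%:E).
  by rewrite ge0_integral_pushforward// preimage_setT.
transitivity (\int[density_measure lebesgue_measure
    (measurable_normal_pdf (m i) sigma) (normal_pdf_ge0 (m i) sigma)]_y
    (g y)%:E).
  by apply: eq_measure_integral => A mA _; exact: law.
by rewrite ge0_integral_density.
Qed.

Lemma tilt_expectation (Q : probability (observation R) R) m i
    (B : set (measurableTypeR R)) :
  gaussian_coordinates Q (fun=> 0%R) -> measurable B ->
  \int[Q]_a (tilt v m (a i) * \1_B (a i))%:E = normal_prob m sigma B.
Proof.
move=> Q0 mB.
rewrite (gaussian_coordinate_integral i
  (g := fun x => (tilt v m x * \1_B x)%R) Q0).
- rewrite /normal_prob [RHS]integral_mkcond; apply: eq_integral => x _.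
  by rewrite epatch_indic -EFinM (normal_pdf_tilt v0 m) mulrAC.
- by apply: measurable_funM; [exact: measurable_tilt|exact: measurable_indic].
- by move=> x; rewrite mulr_ge0// tilt_ge0.
Qed.

End gaussian_coordinates.

Lemma indic_cylinder (R : realType) (S : seq wavelet_index)
    (B : wavelet_index -> set (measurableTypeR R)) (a : observation R) :
  (\1_(cylinder S B) a = \prod_(i <- S) \1_(B i) (a i) :> R).
Proof.
elim: S => [|i S IH]; first by rewrite big_nil indicE mem_set.
rewrite big_cons -IH -[RHS]/((\1_((fun a : observation R => a i) @^-1` B i)
  \* \1_(cylinder S B)) a) -indicI.
congr (\1_ _ _); apply/seteqP; split=> [x xB|x [xBi xB] j].
  by split=> [|j jS]; apply: xB; rewrite in_cons ?eqxx ?jS ?orbT.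
by rewrite in_cons => /orP[/eqP->//|]; exact: xB.
Qed.

Lemma prod_extend (R : comNzRingType) (T : eqType) (I U : seq T) (F : T -> R) :
  uniq I -> uniq U -> {subset I <= U} -> (forall i, i \notin I -> F i = 1) ->
  \prod_(i <- U) F i = \prod_(i <- I) F i.
Proof.
move=> uI uU IU F1; rewrite (bigID (mem I))/= [X in _ * X]big1 ?mulr1//.
rewrite -big_filter; apply: perm_big; apply: uniq_perm => //.
  exact: filter_uniq.
by move=> i; rewrite mem_filter; case: (boolP (i \in I)) => // /IU ->.
Qed.

Section likelihood.
Context {R : realType}.
Variable v : R.
Hypothesis v0 : 0 < v.
Local Open Scope ereal_scope.

(** On a cylinder, the probability under Q and the integral of the product of
    tilts both factor over the coordinates that occur in the cylinder or in I,
    and the factors agree; cylinders determine the measure. *)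
Lemma gaussian_likelihood (Q0 Q : probability (observation R) R)
    (m : wavelet_index -> R) (I : seq wavelet_index) :
  gaussian_coordinates v Q0 (fun=> 0%R) -> gaussian_coordinates v Q m ->
  uniq I -> (forall i, i \notin I -> m i = 0%R) ->
  forall A, measurable A ->
  Q A = \int[Q0]_(a in A) (\prod_(i <- I) tilt v (m i) (a i))%:E.
Proof.
move=> gQ0 gQ uI mI.
have mL := measurable_prod_coordinates (fun i => measurable_tilt v (m i)) I.
have L0 (a : observation R) : (0 <= \prod_(i <- I) tilt v (m i) (a i))%R.
  by apply: prodr_ge0 => i _; exact: tilt_ge0.
pose nu := density_measure Q0 mL L0.
apply: (@cylinder_measure_unique R Q nu).
  by rewrite -ge0_fin_numE//; exact: fin_num_measure.
move=> S B mB.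
pose U := undup (S ++ I).
pose B' i := [set x : measurableTypeR R | i \in S -> B i x].
have mB' i : measurable (B' i) by apply: measurable_guard.
have SU : {subset S <= U} by move=> i iS; rewrite mem_undup mem_cat iS.
have IU : {subset I <= U} by move=> i iI; rewrite mem_undup mem_cat iI orbT.
have uU : uniq U by exact: undup_uniq.
rewrite [RHS](_ : _ = \int[Q0]_(a in cylinder S B)
  (\prod_(i <- I) tilt v (m i) (a i))%:E)//.
rewrite (cylinder_widen B SU) -/B' [LHS](gQ.1 U B' uU mB').
pose g i (x : R) := (tilt v (m i) x * \1_(B' i) x)%R.
have mg i : measurable_fun [set: measurableTypeR R] (g i).
  by apply: measurable_funM; [exact: measurable_tilt|exact: measurable_indic].
have g0 i x : (0 <= g i x)%R by rewrite mulr_ge0// tilt_ge0.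
have gE i : \int[Q0]_a (g i (a i))%:E = Q [set a | B' i (a i)].
  by rewrite tilt_expectation// gQ.2.
transitivity (\int[Q0]_a (\prod_(i <- U) g i (a i))%:E).
  rewrite (expectation_prod gQ0.1 mg g0 uU); last first.
    move=> i _; rewrite gE -ge0_fin_numE//; apply: fin_num_measure.
    by rewrite -[X in measurable X]setTI; exact: measurable_coordinate.
  by apply: eq_bigr => i _; rewrite gE.
rewrite [RHS]integral_mkcond; apply: eq_integral => a _.
rewrite epatch_indic -EFinM big_split/= indic_cylinder; congr (_ * _)%:E.
apply: prod_extend => // i iI.
by rewrite mI// tilt0.
Qed.

(** Up to constants, the square of the average of the two tilts by m and - m is
    a combination of tilts by 2 m, - 2 m and 0, each of expectation 1. *)
Lemma tilt_mixture_second_moment (Q : probability (observation R) R) m i :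
  gaussian_coordinates v Q (fun=> 0%R) ->
  \int[Q]_a (((tilt v m (a i) + tilt v (- m) (a i)) / 2) ^+ 2)%:E =
  ((expR (v * m ^+ 2) + expR (- (v * m ^+ 2))) / 2)%:E.
Proof.
move=> gQ; pose s := ((Num.sqrt v)^-1)%R.
pose E := expR (v * m ^+ 2); pose E' := expR (- (v * m ^+ 2)).
rewrite (gaussian_coordinate_integral i
  (g := fun x => (((tilt v m x + tilt v (- m) x) / 2) ^+ 2)%R) gQ);
  last 2 first.
- apply: measurable_funX; apply: measurable_funM => //.
  by apply: measurable_funD; exact: measurable_tilt.
- by move=> x; rewrite sqr_ge0.
transitivity (\int[lebesgue_measure]_x
    ((E / 4)%:E * (normal_pdf (2 * m) s x)%:E +
     (E / 4)%:E * (normal_pdf (2 * - m) s x)%:E +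
     (E' / 2)%:E * (normal_pdf 0 s x)%:E)).
  apply: eq_integral => x _; rewrite -!EFinM -!EFinD; congr EFin.
  rewrite (normal_pdf_tilt v0 (2 * m)) (normal_pdf_tilt v0 (2 * - m)) -/s.
  rewrite expr_div_n sqrrD tilt_sqr tilt_sqr tilt_mulN sqrrN -/E -/E' mulr2n.
  by field.
have mp c : measurable_fun [set: measurableTypeR R]
    (fun x => (normal_pdf c s x)%:E).
  by apply/measurable_EFinP; exact: measurable_normal_pdf.
have p0 c x : 0 <= (normal_pdf c s x)%:E by rewrite lee_fin normal_pdf_ge0.
have E0 : (0 <= E / 4)%R by rewrite divr_ge0// expR_ge0.
have E'0 : (0 <= E' / 2)%R by rewrite divr_ge0// expR_ge0.
have mEp c k : measurable_fun [set: measurableTypeR R]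
    (fun x => k%:E * (normal_pdf c s x)%:E).
  by apply: measurable_funeM; exact: mp.
have Ep0 c k x : (0 <= k)%R -> 0 <= k%:E * (normal_pdf c s x)%:E.
  by move=> k0; rewrite mule_ge0.
rewrite ge0_integralD//; last 3 first.
- by move=> x _; rewrite adde_ge0// Ep0.
- by apply: emeasurable_funD.
- by move=> x _; exact: Ep0.
rewrite ge0_integralD//; last 2 first.
- by move=> x _; exact: Ep0.
- by move=> x _; exact: Ep0.
rewrite !ge0_integralZl_EFin// !integral_normal_pdf !mule1 -!EFinD.
by rewrite -/E -/E'; congr EFin; field.
Qed.

End likelihood.

(** * Testing against a mixture *)

(** With Q(H) = 1 the chi-square divergence is w - 1.  Bounding
    (1_A - 1/2) (H - 1) pointwise by (H - 1)^2 / (4 c) + c / 4 replaces the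
    Cauchy-Schwarz inequality; the best c is the square root of w - 1. *)
Lemma chi_square_testing (R : realType) d (T : measurableType d)
    (Q : probability T R) (H : T -> R) (w c : R) (A : set T) :
  measurable_fun [set: T] H -> (forall x, 0 <= H x) ->
  (\int[Q]_x (H x)%:E = 1)%E -> (\int[Q]_x (H x ^+ 2)%:E <= w%:E)%E ->
  0 < c -> measurable A ->
  (\int[Q]_(x in A) (H x)%:E <= Q A + ((w - 1) / (4 * c) + c / 4)%:E)%E.
Proof.
move=> mH H0 H1 H2 c0 mA.
have intD (f g : T -> R) : measurable_fun [set: T] f ->
    measurable_fun [set: T] g -> (forall x, 0 <= f x) -> (forall x, 0 <= g x) ->
    (\int[Q]_x (f x + g x)%:E = \int[Q]_x (f x)%:E + \int[Q]_x (g x)%:E)%E.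
  move=> mf mg f0 g0; under eq_integral do rewrite EFinD.
  apply: ge0_integralD => //; try exact/measurable_EFinP.
  - by move=> x _; rewrite lee_fin.
  - by move=> x _; rewrite lee_fin.
have intZ k (f : T -> R) : 0 <= k -> measurable_fun [set: T] f ->
    (forall x, 0 <= f x) ->
    (\int[Q]_x (k * f x)%:E = k%:E * \int[Q]_x (f x)%:E)%E.
  move=> k0 mf f0; under eq_integral do rewrite EFinM.
  apply: ge0_integralZl_EFin => //; last exact/measurable_EFinP.
  by move=> x _; rewrite lee_fin.
have intk k : (\int[Q]_x k%:E = k%:E)%E.
  rewrite integral_cst// [X in (_ * X)%E](_ : _ = 1%E) ?mule1//.
  exact: probability_setT.
have mHA : measurable_fun [set: T] (H \* \1_A).
  by apply: measurable_funM => //; exact: measurable_indic.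
have mkH k : measurable_fun [set: T] (fun x => k * H x).
  exact: measurable_funM.
have mkH2 k : measurable_fun [set: T] (fun x => k * H x ^+ 2).
  by apply: measurable_funM => //; exact: measurable_funX.
have k1 : 0 <= (2 * c)^-1 by rewrite invr_ge0 mulr_ge0// ltW.
have k2 : 0 <= (4 * c)^-1 by rewrite invr_ge0 mulr_ge0// ltW.
have k3 : 0 <= (4 * c)^-1 + c / 4 by rewrite addr_ge0// divr_ge0// ltW.
have HA0 x : 0 <= (H \* \1_A) x by rewrite mulr_ge0.
(* The pointwise bound, with the negative terms of each side moved to the
   other one so that all integrands are nonnegative. *)
have key x : (H \* \1_A) x + ((2 * c)^-1 * H x + 2^-1) <=
    \1_A x + (2^-1 * H x + ((4 * c)^-1 * H x ^+ 2 + ((4 * c)^-1 + c / 4))).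
  rewrite -subr_ge0 [X in 0 <= X](_ : _ =
    (H x - 1 - (2 * \1_A x - 1) * c) ^+ 2 / (4 * c)); last first.
    by rewrite /= !indicE; case: (x \in A); rewrite ?mulr1n ?mulr0n; field;
      exact: lt0r_neq0.
  by rewrite mulr_ge0// sqr_ge0.
have : (\int[Q]_x ((H \* \1_A) x + ((2 * c)^-1 * H x + 2^-1))%:E <=
    \int[Q]_x (\1_A x + (2^-1 * H x +
      ((4 * c)^-1 * H x ^+ 2 + ((4 * c)^-1 + c / 4))))%:E)%E.
  apply: ge0_le_integral => //.
  - by move=> x _; rewrite lee_fin !addr_ge0// mulr_ge0.
  - apply/measurable_EFinP; apply: measurable_funD => //.
    by apply: measurable_funD.
  - apply/measurable_EFinP; apply: measurable_funD => //.
    by apply: measurable_funD => //; apply: measurable_funD.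
  - by move=> x _; rewrite lee_fin key.
have r0 x : 0 <= (2 * c)^-1 * H x + 2^-1 by rewrite addr_ge0// mulr_ge0.
have sq0 x : 0 <= (4 * c)^-1 * H x ^+ 2 by rewrite mulr_ge0// sqr_ge0.
have h0 x : 0 <= 2^-1 * H x by rewrite mulr_ge0.
have s0 x : 0 <= (4 * c)^-1 * H x ^+ 2 + ((4 * c)^-1 + c / 4).
  by rewrite addr_ge0.
have t0 x : 0 <= 2^-1 * H x + ((4 * c)^-1 * H x ^+ 2 + ((4 * c)^-1 + c / 4)).
  by rewrite addr_ge0.
have mr : measurable_fun [set: T] (fun x => (2 * c)^-1 * H x + 2^-1).
  exact: measurable_funD.
have ms : measurable_fun [set: T]
    (fun x => (4 * c)^-1 * H x ^+ 2 + ((4 * c)^-1 + c / 4)).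
  exact: measurable_funD.
have mt : measurable_fun [set: T]
    (fun x => 2^-1 * H x + ((4 * c)^-1 * H x ^+ 2 + ((4 * c)^-1 + c / 4))).
  exact: measurable_funD.
have m1A : measurable_fun [set: T] (\1_A : T -> R) by exact: measurable_indic.
have one0 x : 0 <= \1_A x :> R by [].
have cst0 (x : T) : 0 <= 2^-1 :> R by [].
rewrite (intD _ _ mHA mr HA0 r0).
rewrite (intD _ _ (mkH _) (@measurable_cst _ _ _ _ _ _) _ cst0); last first.
  by move=> x; rewrite mulr_ge0.
rewrite intZ// H1 mule1 intk.
rewrite (intD _ _ m1A mt one0 t0) (intD _ _ (mkH _) ms h0 s0) intZ// H1 mule1.
rewrite (intD _ _ (mkH2 _) (@measurable_cst _ _ _ _ _ _) sq0 (fun=> k3)) intk.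
rewrite intZ//; last 2 first.
- exact: measurable_funX.
- by move=> x; rewrite sqr_ge0.
rewrite integral_indic// setIT.
have -> : (\int[Q]_x ((H \* \1_A) x)%:E = \int[Q]_(x in A) (H x)%:E)%E.
  rewrite [RHS]integral_mkcond; apply: eq_integral => x _.
  by rewrite epatch_indic EFinM.
have QAfin : Q A \is a fin_num by exact: fin_num_measure.
rewrite -(fineK QAfin); set q := fine (Q A).
have : ((4 * c)^-1%:E * \int[Q]_x (H x ^+ 2)%:E <= ((4 * c)^-1 * w)%:E)%E.
  by rewrite EFinM; apply: lee_wpmul2l; rewrite // lee_fin.
set y := (X in (X <= _)%E) => yw.
move=> ineq; have : (\int[Q]_(x in A) (H x)%:E + ((2 * c)^-1 + 2^-1)%:E <=
    (q + (2^-1 + ((4 * c)^-1 * w + ((4 * c)^-1 + c / 4))))%:E)%E.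
  rewrite EFinD; apply: (le_trans ineq); rewrite !EFinD.
  apply: leeD; first by rewrite /q fineK.
  by apply: leeD2l; exact: leeD2r.
rewrite -leeBrDr// -EFinB => /le_trans; apply.
rewrite -EFinD lee_fin le_eqVlt.
by apply/orP; left; apply/eqP; field; exact: lt0r_neq0.
Qed.

(** * Inner product and norm of L2([0,1]) *)

Section L2_space.
Context {R : realType}.
Implicit Types (f g h : R -> R).

Lemma L2_linear (c : R) g h : L2 g -> L2 h -> L2 (fun x => c * g x + h x).
Proof.
have p1 : (1 <= 2%:E :> \bar R)%E by rewrite lee_fin ler1n.
exact: (Lfun_submod_closed (@unit_lebesgue R) p1).2.
Qed.

Lemma L2_0 : L2 (fun=> 0 : R).
Proof.
have p1 : (1 <= 2%:E :> \bar R)%E by rewrite lee_fin ler1n.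
exact: (Lfun_submod_closed (@unit_lebesgue R) p1).1.
Qed.

Lemma L2_sum (I : Type) (r : seq I) (c : I -> R) (u : I -> R -> R) :
  (forall i, L2 (u i)) -> L2 (fun x => \sum_(i <- r) c i * u i x).
Proof.
move=> L2u; elim: r => [|i r IH].
  by rewrite (_ : (fun _ => _) = (fun=> 0)); [exact: L2_0|
    apply/funext => x; rewrite big_nil].
rewrite (_ : (fun _ => _) =
  (fun x => c i * u i x + \sum_(j <- r) c j * u j x)); first exact: L2_linear.
by apply/funext => x; rewrite big_cons.
Qed.

Lemma L2B f h : L2 f -> L2 h -> L2 (f \- h)%R.
Proof.
move=> L2f L2h; rewrite (_ : (f \- h)%R = (fun x => -1 * h x + f x)).
  exact: L2_linear.
by apply/funext => x /=; rewrite mulN1r addrC.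
Qed.

Lemma L2_integrable_mul f g : L2 f -> L2 g ->
  (@unit_lebesgue R).-integrable setT (EFin \o (fun x => f x * g x)).
Proof. by move=> L2f L2g; apply/Lfun1_integrable; exact: Lfun2_mul_Lfun1. Qed.

Lemma L2innerC f g : L2inner f g = L2inner g f.
Proof. by apply: eq_Rintegral => x _; rewrite mulrC. Qed.

Lemma L2inner0 g : L2inner (fun=> 0) g = 0.
Proof.
rewrite /L2inner; under eq_Rintegral do rewrite mul0r.
by rewrite /Rintegral integral0.
Qed.

Lemma L2inner_linear (c : R) f g h : L2 f -> L2 g -> L2 h ->
  L2inner (fun x => c * f x + g x) h = c * L2inner f h + L2inner g h.
Proof.
move=> L2f L2g L2h.
rewrite /L2inner -RintegralZl//; last exact: L2_integrable_mul.
rewrite -RintegralD//; last 2 first.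
- rewrite (_ : EFin \o _ = fun x => (c%:E * (f x * h x)%:E)%E).
    by apply: integrableZl => //; exact: L2_integrable_mul.
  by apply/funext => x; rewrite /= EFinM.
- exact: L2_integrable_mul.
by apply: eq_Rintegral => x _; rewrite mulrDl mulrA.
Qed.

Lemma L2inner_sum (I : Type) (r : seq I) (c : I -> R) (u : I -> R -> R) h :
  (forall i, L2 (u i)) -> L2 h ->
  L2inner (fun x => \sum_(i <- r) c i * u i x) h =
  \sum_(i <- r) c i * L2inner (u i) h.
Proof.
move=> L2u L2h; elim: r => [|i r IH].
  rewrite big_nil (_ : (fun _ => _) = (fun=> 0)) ?L2inner0//.
  by apply/funext => x; rewrite big_nil.
rewrite big_cons -IH -L2inner_linear//; last exact: L2_sum.
by congr L2inner; apply/funext => x; rewrite big_cons.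
Qed.

Lemma L2innerB f g h : L2 f -> L2 g -> L2 h ->
  L2inner (f \- g)%R h = L2inner f h - L2inner g h.
Proof.
move=> L2f L2g L2h; rewrite (_ : (f \- g)%R = (fun x => -1 * g x + f x)).
  by rewrite L2inner_linear// mulN1r addrC.
by apply/funext => x /=; rewrite mulN1r addrC.
Qed.

(** The Cauchy-Schwarz inequality for the unit vector f / D. *)
Lemma L2inner_le_norm f g (D : R) : L2 f -> L2 g -> 0 < D ->
  L2inner f f = D ^+ 2 -> ((L2inner g f / D)%:E <= L2norm g)%E.
Proof.
move=> L2f L2g D0 ffD.
have mL2 h : L2 h -> measurable_fun [set: measurableTypeR R] h.
  by move=> /andP[mh _]; rewrite inE in mh.
have normf : L2norm f = D%:E.
  rewrite /L2norm unlock.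
  have -> : (\int[@unit_lebesgue R]_x `|(EFin \o f) x| `^ 2 =
      (D ^+ 2)%:E)%E.
    rewrite -ffD /L2inner /Rintegral fineK; last first.
      by apply: integrable_fin_num => //; exact: L2_integrable_mul.
    apply: eq_integral => x _.
    by rewrite /= powR_mulrn// real_normK ?num_real.
  by rewrite poweR_EFin -powR_mulrn ?ltW// -powRrM mulfV// powRr1 ?ltW.
have h1 : (`|L2inner g f|%:E <= 'N[@unit_lebesgue R]_1[EFin \o (g \* f)%R])%E.
  rewrite Lnorm1 /L2inner; apply: le_trans (le_abse_integral _ _ _) => //.
    rewrite /Rintegral -[in leRHS](@fineK _ (integral _ _ _)) ?lexx//.
    by apply: integrable_fin_num => //; exact: L2_integrable_mul.
  by have /integrableP[] := L2_integrable_mul L2g L2f.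
have h2 : (`|L2inner g f|%:E <= L2norm g * D%:E)%E.
  rewrite -normf; apply: (le_trans h1).
  by apply: hoelder => //; [exact: mL2|exact: mL2|rewrite [RHS]splitr !div1r].
rewrite EFinM lee_pdivrMr//; apply: le_trans h2.
by rewrite lee_fin ler_norm.
Qed.

End L2_space.

(** * Functions carried by one resolution level *)

Section resolution_level.
Context {R : realType}.
Variable psi : nat -> nat -> R -> R.
Hypothesis hpsi : orthonormal_basis psi.
Variable J : nat.
Hypothesis J2 : (2 <= J)%N.
Implicit Types (c : 'I_(2 ^ J) -> R).

Let level_indexP (k : 'I_(2 ^ J)) :
  (2 <= (J, k.+1).1)%N && (1 <= (J, k.+1).2 <= 2 ^ (J, k.+1).1)%N.
Proof. by rewrite J2 /=. Qed.

Definition level_index (k : 'I_(2 ^ J)) : wavelet_index :=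
  exist _ (J, k.+1) (level_indexP k).

Lemma level_index_inj : injective level_index.
Proof. by move=> k l /(congr1 val)[] kl; apply: val_inj. Qed.

Definition level_indices : seq wavelet_index :=
  [seq level_index k | k <- enum 'I_(2 ^ J)].

Lemma uniq_level_indices : uniq level_indices.
Proof. by rewrite map_inj_uniq ?enum_uniq//; exact: level_index_inj. Qed.

Lemma mem_level_indices (i : wavelet_index) :
  (i \in level_indices) = ((val i).1 == J).
Proof.
apply/mapP/eqP => [[k _ ->//]|].
case: i => -[j k] /= jk ej; move: jk; rewrite ej /= => jk.
have [_ /andP[k1 kJ]] := andP jk.
have kJ' : (k.-1 < 2 ^ J)%N by rewrite prednK.
exists (Ordinal kJ'); first by rewrite mem_enum.
by apply: val_inj; rewrite /= prednK.
Qed.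

Definition level_fun c (x : R) : R := \sum_(k < 2 ^ J) c k * psi J k.+1 x.

Let L2psi i : L2 (wavelet psi i). Proof. by have [+ _ _] := hpsi; apply. Qed.

Lemma L2_level_fun c : L2 (level_fun c).
Proof. by apply: L2_sum => k; exact: (L2psi (level_index k)). Qed.

Lemma L2inner_level_fun c h : L2 h ->
  L2inner (level_fun c) h = \sum_(k < 2 ^ J) c k * L2inner (psi J k.+1) h.
Proof.
by move=> L2h; rewrite L2inner_sum// => k; exact: (L2psi (level_index k)).
Qed.

Let L2inner_psi i i' : L2inner (wavelet psi i) (wavelet psi i') = (i == i')%:R.
Proof. by have [_ + _] := hpsi; apply. Qed.

Lemma level_fun_coef c (k : 'I_(2 ^ J)) :
  L2inner (level_fun c) (psi J k.+1) = c k.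
Proof.
rewrite (L2inner_level_fun _ (L2psi (level_index k))) (bigD1 k)//= big1 ?addr0.
  have := L2inner_psi (level_index k) (level_index k).
  by rewrite eqxx => ->; rewrite mulr1.
move=> l lk; have := L2inner_psi (level_index l) (level_index k).
rewrite (inj_eq level_index_inj) (negPf lk) => ->.
by rewrite mulr0.
Qed.

Lemma level_fun_coef_off c i : (val i).1 != J ->
  L2inner (level_fun c) (wavelet psi i) = 0.
Proof.
move=> iJ; rewrite L2inner_level_fun//; apply: big1 => k _.
have := L2inner_psi (level_index k) i.
rewrite (_ : (_ == _) = false) => [->|]; first by rewrite mulr0.
by apply: contraNF iJ => /eqP <-.
Qed.

Lemma level_fun_sqnorm c :
  L2inner (level_fun c) (level_fun c) = \sum_(k < 2 ^ J) c k ^+ 2.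
Proof.
rewrite L2inner_level_fun; last exact: L2_level_fun.
by apply: eq_bigr => k _; rewrite L2innerC level_fun_coef expr2.
Qed.

Local Open Scope ereal_scope.

Let besov_term (r : R) g j : \bar R := (4 `^ (j%:R * r))%:E *
  \sum_(1 <= k < (2 ^ j).+1) (L2inner g (psi j k) ^+ 2)%:E.

Let besov_term_ge0 r g j : 0 <= besov_term r g j.
Proof.
rewrite mule_ge0 ?lee_fin ?powR_ge0// sume_ge0// => k _.
by rewrite lee_fin sqr_ge0.
Qed.

Let besov_term_level r g : besov_term r g J =
  (4 `^ (J%:R * r) * \sum_(k < 2 ^ J) L2inner g (psi J k.+1) ^+ 2)%:E.
Proof. by rewrite /besov_term big_add1/= big_mkord sumEFin. Qed.

Lemma besov_norm_level (r rad : R) g : (0 <= rad)%R ->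
  besov_norm psi r g <= rad%:E ->
  (4 `^ (J%:R * r) * \sum_(k < 2 ^ J) L2inner g (psi J k.+1) ^+ 2
     <= rad ^+ 2)%R.
Proof.
move=> rad0; have -> : rad%:E = sqrte (rad ^+ 2)%:E.
  by rewrite /= sqrtr_sqr ger0_norm.
rewrite /besov_norm lee_sqrt ?lee_fin ?sqr_ge0// => normg.
rewrite -lee_fin -besov_term_level; apply: le_trans normg.
apply: (@le_trans _ _ (\sum_(2 <= j < J.+1) besov_term r g j)).
  by rewrite big_nat_recr//= leeDr// sume_ge0.
by apply: nneseries_lim_ge => j _ _; exact: besov_term_ge0.
Qed.

Lemma besov_norm_level_fun (r rad : R) c : (0 <= rad)%R ->
  (4 `^ (J%:R * r) * \sum_(k < 2 ^ J) c k ^+ 2 <= rad ^+ 2)%R ->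
  besov_norm psi r (level_fun c) <= rad%:E.
Proof.
move=> rad0 crad; have -> : rad%:E = sqrte (rad ^+ 2)%:E.
  by rewrite /= sqrtr_sqr ger0_norm.
rewrite /besov_norm lee_sqrt ?lee_fin ?sqr_ge0//.
apply: lime_le.
  by apply: is_cvg_nneseries => j _ _; exact: besov_term_ge0.
apply: nearW => N.
have term0 j : (2 <= j)%N -> j != J -> besov_term r (level_fun c) j = 0.
  move=> j2 jJ; rewrite /besov_term big_nat big1 ?mule0// => k /andP[k1 kj].
  have kj' : (2 <= (j, k).1)%N && (1 <= (j, k).2 <= 2 ^ (j, k).1)%N.
    by rewrite /= j2 k1 -ltnS.
  have := @level_fun_coef_off c (exist _ (j, k) kj') jJ.
  by rewrite /wavelet/= => ->; rewrite expr0n.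
have termJ : besov_term r (level_fun c) J <= (rad ^+ 2)%:E.
  rewrite besov_term_level lee_fin; apply: le_trans crad.
  by under eq_bigr do rewrite level_fun_coef.
have [JN|JN] := ltnP J N; last first.
  rewrite big_nat big1 ?lee_fin ?sqr_ge0// => j /andP[j2 jN].
  by apply: term0 => //; rewrite neq_ltn (leq_trans jN JN).
rewrite (bigD1_seq J) ?mem_index_iota ?J2 ?JN ?iota_uniq//=.
rewrite [X in _ + X]big1_seq ?adde0// => j /andP[jJ].
by rewrite mem_index_iota => /andP[j2 _]; exact: term0.
Qed.

(** By orthogonality only the level-J coefficients of h correlate with a
    level-J function f, and membership of h in the s-ball bounds their norm by
    b; hence the inner product of f - h with the unit vector f / D is at least
    D - b. *)
Lemma level_fun_separated (s rad D b : R) c h :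
  (0 < rad)%R -> (0 < D)%R -> (0 < b)%R -> besov_ball psi s rad h ->
  (\sum_(k < 2 ^ J) c k ^+ 2 = D ^+ 2)%R ->
  (rad ^+ 2 = 4 `^ (J%:R * s) * b ^+ 2)%R ->
  (D - b)%:E <= L2norm (level_fun c \- h)%R.
Proof.
move=> rad0 D0 b0 [L2h normh] cD radb; have L2f := L2_level_fun c.
have hb : (\sum_(k < 2 ^ J) L2inner h (psi J k.+1) ^+ 2 <= b ^+ 2)%R.
  have := besov_norm_level (ltW rad0) normh.
  by rewrite radb ler_pM2l// powR_gt0.
have hf : (L2inner h (level_fun c) <= D * b)%R.
  rewrite L2innerC L2inner_level_fun//.
  (* Young's inequality, with weights for which the sum is D * b *)
  apply: (@le_trans _ _ (\sum_(k < 2 ^ J) (b / (2 * D) * c k ^+ 2 +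
     D / (2 * b) * L2inner h (psi J k.+1) ^+ 2))%R).
    apply: ler_sum => k _; rewrite (L2innerC (psi J k.+1)) -subr_ge0.
    set y := L2inner h _; rewrite [X in (0 <= X)%R](_ : _ =
      (b * c k - D * y) ^+ 2 / (2 * D * b))%R; last first.
      by field; rewrite !lt0r_neq0.
    by rewrite divr_ge0 ?sqr_ge0// !mulr_ge0// ltW.
  rewrite big_split/= -!mulr_sumr cD.
  apply: (@le_trans _ _ (b / (2 * D) * D ^+ 2 + D / (2 * b) * b ^+ 2)%R).
    by rewrite lerD2l ler_wpM2l// divr_ge0 ?mulr_ge0// ltW.
  by rewrite le_eqVlt; apply/orP; left; apply/eqP; field; rewrite !lt0r_neq0.
apply: le_trans (L2inner_le_norm L2f (L2B L2f L2h) D0 _).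
  rewrite lee_fin L2innerB// level_fun_sqnorm cD ler_pdivlMr//.
  by rewrite mulrBl -expr2 lerD2l lerN2 [leRHS]mulrC.
by rewrite level_fun_sqnorm cD.
Qed.

End resolution_level.

(** * The random-sign mixture at one level *)

Section mixture.
Context {R : realType}.
Variable psi : nat -> nat -> R -> R.
Hypothesis hpsi : orthonormal_basis psi.
Variable J : nat.
Hypothesis J2 : (2 <= J)%N.
Variable (n : nat) (P : (R -> R) -> probability (observation R) R).
Hypothesis wn : white_noise_model psi n P.
Hypothesis n0 : (0 < n)%N.
Variable alpha : R.
Local Notation v := (n%:R : R).
Local Notation m := (2 ^ J)%N.

Let v0 : 0 < v. Proof. by rewrite ltr0n. Qed.

Definition sign_coef (xi : {ffun 'I_m -> bool}) (k : 'I_m) : R :=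
  if xi k then alpha else - alpha.

Definition sign_fun (xi : {ffun 'I_m -> bool}) : R -> R :=
  level_fun psi (sign_coef xi).

Lemma sum_sign_coef xi :
  \sum_(k < m) sign_coef xi k ^+ 2 = m%:R * alpha ^+ 2.
Proof.
rewrite (eq_bigr (fun=> alpha ^+ 2)).
  by rewrite sumr_const card_ord mulr_natl.
by move=> k _; rewrite /sign_coef; case: (xi k); rewrite ?sqrrN.
Qed.

Lemma white_noise_gaussian f : L2 f ->
  gaussian_coordinates v (P f) (fun i => L2inner f (wavelet psi i)).
Proof. by move=> L2f; have [indep law] := wn L2f; split. Qed.

Lemma white_noise_gaussian0 :
  gaussian_coordinates v (P (fun=> 0%R)) (fun=> 0).
Proof.
have [indep law] := white_noise_gaussian (@L2_0 R); split=> // i B mB.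
by rewrite law// L2inner0.
Qed.

Definition mixture_likelihood (a : observation R) : R :=
  \prod_(i <- level_indices J2)
    ((tilt v alpha (a i) + tilt v (- alpha) (a i)) / 2).

Let h (x : R) : R := (tilt v alpha x + tilt v (- alpha) x) / 2.

Let mh : measurable_fun [set: measurableTypeR R] h.
Proof.
by apply: measurable_funM => //; apply: measurable_funD; exact: measurable_tilt.
Qed.

Let h0 x : 0 <= h x.
Proof. by rewrite divr_ge0// addr_ge0// tilt_ge0. Qed.

Lemma measurable_mixture_likelihood :
  measurable_fun [set: observation R] mixture_likelihood.
Proof. exact: (measurable_prod_coordinates (fun=> mh)). Qed.

Lemma mixture_likelihood_ge0 a : 0 <= mixture_likelihood a.
Proof. by apply: prodr_ge0 => i _; exact: h0. Qed.

(** Distributivity turns the sum over all signs of the products of tilts into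
    the product over the coordinates of the sum of the two tilts. *)
Lemma mixture_likelihoodE (A : set (observation R)) : measurable A ->
  (\sum_(xi : {ffun 'I_m -> bool}) P (sign_fun xi) A =
   (2 ^+ m)%:E * \int[P (fun=> 0%R)]_(a in A) (mixture_likelihood a)%:E)%E.
Proof.
move=> mA; have gQ0 := white_noise_gaussian0.
pose L (xi : {ffun 'I_m -> bool}) (a : observation R) : R :=
  \prod_(k < m) tilt v (sign_coef xi k) (a (level_index J2 k)).
have LE xi (a : observation R) : L xi a = \prod_(i <- level_indices J2)
    tilt v (L2inner (sign_fun xi) (wavelet psi i)) (a i).
  rewrite big_map big_enum/=; apply: eq_bigr => k _.
  by rewrite [L2inner _ _](level_fun_coef hpsi J2).
have L0 xi a : 0 <= L xi a by apply: prodr_ge0 => k _; exact: tilt_ge0.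
have mL xi : measurable_fun [set: observation R] (L xi).
  rewrite (funext (LE xi)).
  exact: (measurable_prod_coordinates (fun i => measurable_tilt v
    (L2inner (sign_fun xi) (wavelet psi i)))).
rewrite (eq_bigr (fun xi =>
  \int[P (fun=> 0%R)]_(a in A) (L xi a)%:E)%E); last first.
  move=> xi _; rewrite (gaussian_likelihood v0 gQ0
    (white_noise_gaussian (L2_level_fun hpsi J2 (sign_coef xi)))
    (uniq_level_indices J2) _ mA); last first.
    move=> i; rewrite mem_level_indices.
    exact: (level_fun_coef_off hpsi J2).
  by apply: eq_integral => a _; rewrite LE.
rewrite -ge0_integral_sum//; last 2 first.
- by move=> xi; apply/measurable_EFinP/measurable_funTS.
- by move=> xi a _; rewrite lee_fin.
rewrite -ge0_integralZl_EFin ?exprn_ge0//; last 2 first.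
- by move=> a _; rewrite lee_fin mixture_likelihood_ge0.
- apply/measurable_EFinP/measurable_funTS; exact: measurable_mixture_likelihood.
apply: eq_integral => a _; rewrite sumEFin -EFinM; congr EFin.
rewrite /mixture_likelihood big_map big_enum/=.
have -> : (2 ^+ m : R) = \prod_(k < m) 2 by rewrite prodr_const card_ord.
rewrite -big_split/= (eq_bigr (fun k => \sum_(b : bool)
    tilt v (if b then alpha else - alpha) (a (level_index J2 k)))).
  by rewrite bigA_distr_bigA.
by move=> k _; rewrite mulrC divfK// big_bool.
Qed.

(** The case of the sure event in [mixture_likelihoodE]. *)
Lemma integral_mixture_likelihood :
  (\int[P (fun=> 0%R)]_a (mixture_likelihood a)%:E = 1)%E.
Proof.
have := mixture_likelihoodE measurableT.
rewrite (eq_bigr (fun=> 1%E)) => [|xi _]; last exact: probability_setT.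
rewrite sumEFin sumr_const card_ffun card_bool card_ord natrX => E.
apply/eqP.
rewrite -[X in _ == X](_ : ((2 ^+ m)^-1)%:E * (2 ^+ m)%:E = 1)%E; last first.
  by rewrite -EFinM mulVf ?expf_neq0.
by rewrite E muleA -EFinM mulVf ?expf_neq0// mul1e.
Qed.

Lemma mixture_second_moment :
  (\int[P (fun=> 0%R)]_a (mixture_likelihood a ^+ 2)%:E =
   (((expR (v * alpha ^+ 2) + expR (- (v * alpha ^+ 2))) / 2) ^+ m)%:E)%E.
Proof.
have gQ0 := white_noise_gaussian0.
under eq_integral do rewrite -prodrXl.
have mh2 (i : wavelet_index) :
    measurable_fun [set: measurableTypeR R] (fun x => h x ^+ 2).
  exact: measurable_funX.
have h20 (i : wavelet_index) x : 0 <= h x ^+ 2 by exact: sqr_ge0.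
rewrite (expectation_prod gQ0.1 mh2 h20 (uniq_level_indices J2)); last first.
  by move=> i _; rewrite (tilt_mixture_second_moment v0 _ _ gQ0) ltry.
rewrite (eq_bigr (fun=>
  ((expR (v * alpha ^+ 2) + expR (- (v * alpha ^+ 2))) / 2)%:E)); last first.
  by move=> i _; exact: tilt_mixture_second_moment.
by rewrite prodEFin big_map big_enum/= prodr_const card_ord.
Qed.

(** The bound of [chi_square_testing] with c = 2 (1 - eta) holds for the average
    over xi of P_(f_xi)(A), hence for one of the terms. *)
Lemma sign_fun_indistinguishable (eta : R) (A : set (observation R)) :
  eta < 1 -> measurable A ->
  ((expR (v * alpha ^+ 2) + expR (- (v * alpha ^+ 2))) / 2) ^+ m
    < 1 + 4 * (1 - eta) ^+ 2 ->
  exists xi, (P (sign_fun xi) A < P (fun=> 0%R) A + (1 - eta)%:E)%E.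
Proof.
move=> eta1 mA; set W := _ ^+ m => WE.
have [//|/forallNP far] := pselect (exists xi, (P (sign_fun xi) A <
  P (fun=> 0%R) A + (1 - eta)%:E)%E).
have e0 : 0 < 1 - eta by rewrite subr_gt0.
have c0 : 0 < 2 * (1 - eta) by rewrite mulr_gt0.
have W2 : (\int[P (fun=> 0%R)]_a (mixture_likelihood a ^+ 2)%:E <= W%:E)%E.
  by rewrite mixture_second_moment.
have := chi_square_testing measurable_mixture_likelihood mixture_likelihood_ge0
  integral_mixture_likelihood W2 c0 mA.
have Pfin : P (fun=> 0%R) A \is a fin_num by exact: fin_num_measure.
have : (\sum_(xi : {ffun 'I_m -> bool}) (P (fun=> 0%R) A + (1 - eta)%:E) <=
    \sum_(xi : {ffun 'I_m -> bool}) P (sign_fun xi) A)%E.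
  by apply: lee_sum => xi _; rewrite leNgt; exact/negP/far.
rewrite mixture_likelihoodE// -(fineK Pfin) -EFinD sumEFin sumr_const.
rewrite card_ffun card_bool card_ord -[X in (X%:E <= _)%E]mulr_natl natrX EFinM.
rewrite lee_pmul2l ?fin_numE// ?lte_fin ?exprn_gt0// => le1 le2.
have := le_trans le1 le2; rewrite -EFinD lee_fin lerD2l leNgt => /negP[].
rewrite -subr_gt0 [X in 0 < X](_ : _ =
  (1 + 4 * (1 - eta) ^+ 2 - W) / (8 * (1 - eta))).
  by rewrite divr_gt0 ?subr_gt0// mulr_gt0.
by field; exact: lt0r_neq0.
Qed.

End mixture.

(** * Calibration of the level and of the constant *)

(** From e^z <= 1 / (1 - z), the hyperbolic cosine is at most 1 / (1 - y^2). *)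
Lemma cosh_le (R : realType) (y : R) : y ^+ 2 <= 1 / 2 ->
  (expR y + expR (- y)) / 2 <= 1 + 2 * y ^+ 2.
Proof.
move=> y2.
have h (z : R) : z ^+ 2 <= 1 / 2 -> expR z <= (1 - z)^-1.
  move=> z2; have z1 : 0 < 1 - z by nra.
  rewrite -[expR z]invrK lef_pV2 ?posrE ?invr_gt0 ?expR_gt0// -expRN.
  by have := expR_ge1Dx (- z).
have h1 := h y y2.
have h2 : expR (- y) <= (1 + y)^-1.
  by have := h (- y); rewrite sqrrN opprK; exact.
have p : 0 < 1 - y by nra.
have p' : 0 < 1 + y by nra.
have p2 : 0 < 1 - y ^+ 2 by nra.
apply: (@le_trans _ _ (1 - y ^+ 2)^-1); last first.
  by rewrite -div1r ler_pdivrMr//; nra.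
rewrite [leRHS](_ : _ = ((1 - y)^-1 + (1 + y)^-1) / 2).
  by rewrite ler_pM2r// lerD.
by field; rewrite !lt0r_neq0.
Qed.

Section rates.
Context {R : realType}.

Lemma powR_expR (a x : R) : 0 < a -> a `^ x = expR (x * ln a).
Proof. by move=> a0; rewrite /powR gt_eqF. Qed.

Let two0 : 0 < 2 :> R. Proof. by []. Qed.
Let ln2_gt0 : 0 < ln 2 :> R. Proof. by rewrite ln_gt0// ltr1n. Qed.

(** A level-J function of norm D 2^(-rJ) has Besov norm D for smoothness r. *)
Lemma besov_weight (J : nat) (r D : R) :
  4 `^ (J%:R * r) * (D * 2 `^ (- (r * J%:R))) ^+ 2 = D ^+ 2.
Proof.
have ln4 : ln 4 = 2 * ln 2 :> R.
  by rewrite (_ : 4 = 2 ^+ 2) ?lnXn ?mulr_natl// -natrX.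
rewrite !powR_expR // ln4 exprMn -expRM_natl mulrCA -expRD.
by rewrite (_ : _ + _ = 0) ?expR0 ?mulr1//; ring.
Qed.

(** Since cosh y <= 1 + 2 y^2 <= exp (2 y^2), the m-th power is at most
    exp (2 m y^2).  The constant 32 serves both to keep y^2 below 1/2, as
    ln (1 + b) <= 4, and to make 2 m y^2 smaller than ln (1 + b). *)
Lemma chi_square_budget (m : nat) (y b : R) : (0 < m)%N -> 0 < b -> b <= 4 ->
  m%:R * y ^+ 2 <= (ln (1 + b)) ^+ 2 / 32 ->
  ((expR y + expR (- y)) / 2) ^+ m < 1 + b.
Proof.
move=> m0 b0 b4 my.
have b1 : 0 < 1 + b by rewrite addr_gt0.
set L := ln (1 + b) in my.
have L0 : 0 < L by rewrite /L ln_gt0// ltrDl.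
have L4 : L <= 4 by apply: le_trans b4; rewrite /L le_ln1Dx// (lt_trans _ b0).
have m1 : 1 <= m%:R :> R by rewrite ler1n.
have y2 : y ^+ 2 <= 1 / 2.
  have := sqr_ge0 y; nra.
have cosh0 : 0 <= (expR y + expR (- y)) / 2.
  by rewrite divr_ge0// addr_ge0// expR_ge0.
apply: (@le_lt_trans _ _ (expR (2 * y ^+ 2) ^+ m)).
  rewrite lerXn2r ?nnegrE ?expR_ge0//.
  by apply: le_trans (cosh_le y2) _; exact: expR_ge1Dx.
rewrite -expRM_natl -[ltRHS]lnK ?posrE// ltr_expR -/L.
nra.
Qed.

Variables (s t rad C : R) (n J : nat).
Hypotheses (t0 : 0 < t) (ts : t < s) (rad0 : 0 < rad) (C0 : 0 < C).
Hypothesis n0 : (0 < n)%N.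
Local Notation beta := (2 * t + 1 / 2).
(* J is the integer part of ln n / (beta ln 2). *)
Hypothesis Jle : J%:R * beta * ln 2 <= ln n%:R.
Hypothesis Jgt : ln n%:R < (J%:R + 1) * beta * ln 2.

Let beta0 : 0 < beta. Proof. by move: t0; lra. Qed.
Let nR0 : 0 < n%:R :> R. Proof. by rewrite ltr0n. Qed.

Lemma rate_le_level : n%:R `^ (- (t / beta)) <= 2 `^ (- (t * J%:R)).
Proof.
rewrite !powR_expR// ler_expR !mulNr lerN2 -!(mulrA t).
have h : J%:R * ln 2 <= ln n%:R / beta by rewrite ler_pdivlMr// mulrAC.
by rewrite ler_pM2l// [leRHS]mulrC.
Qed.

(** The hypothesis on n, raised to the power (s - t) / beta, bounds
    rad 2^(s-t) / C by n^((s-t)/beta), which is smaller than 2^((J+1)(s-t)). *)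
Lemma smooth_bias_lt :
  (rad * (2 `^ (s - t) / C)) `^ (beta / (s - t)) <= n%:R ->
  rad * 2 `^ (- (s * J%:R)) < C * 2 `^ (- (t * J%:R)).
Proof.
have st0 : 0 < s - t by rewrite subr_gt0.
set Z := rad * _; have Z0 : 0 < Z by rewrite mulr_gt0// divr_gt0// powR_gt0.
rewrite -[X in _ <= X -> _](@lnK _ n%:R) ?posrE// powR_expR// ler_expR => Zn.
have lnZ : ln Z < (J%:R + 1) * ln 2 * (s - t).
  have : ln Z * beta < (J%:R + 1) * beta * ln 2 * (s - t).
    apply: le_lt_trans (_ : ln n%:R * (s - t) < _); last by rewrite ltr_pM2r.
    by rewrite -ler_pdivrMr// -mulrA mulrC.
  by rewrite (mulrAC _ beta) (mulrAC _ beta) ltr_pM2r.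
have : Z < expR ((J%:R + 1) * ln 2 * (s - t)).
  by rewrite -[ltLHS]lnK ?posrE// ltr_expR.
rewrite /Z mulrA ltr_pdivrMr// !powR_expR//.
rewrite -(ltr_pM2r (expR_gt0 (- ((s - t) * ln 2) - s * J%:R * ln 2))).
rewrite (mulrC _ C) -!mulrA -!expRD.
by congr (_ * expR _ < _ * expR _); ring.
Qed.

(** With n alpha^2 = n D^2 / 2^J the left-hand side is
    16 C^4 n^2 2^(-J(4t+1)), and n^2 < 2^((J+1)(4t+1)). *)
Lemma level_separation_budget (D : R) : D = 2 * C * 2 `^ (- (t * J%:R)) ->
  (2 ^ J)%:R * (n%:R * (D ^+ 2 / (2 ^ J)%:R)) ^+ 2 <= 2 * (2 * C * 2 `^ t) ^+ 4.
Proof.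
move=> ->; have m0 : 0 < (2 ^ J)%:R :> R by rewrite ltr0n expn_gt0.
rewrite !powR_expR//; set q := expR _; set w := expR _.
have mE : (2 ^ J)%:R = expR (J%:R * ln 2) :> R.
  by rewrite expRM_natl lnK ?posrE// natrX.
have nE : n%:R = expR (ln n%:R) :> R by rewrite lnK ?posrE.
have key : n%:R ^+ 2 * q ^+ 4 <= 2 * w ^+ 4 * (2 ^ J)%:R.
  have -> : 2 * w ^+ 4 = expR (ln 2) * w ^+ 4 by rewrite lnK ?posrE.
  rewrite mE [in leLHS]nE /q /w -!expRM_natl -!expRD ler_expR.
  move: Jgt; nra.
rewrite [leLHS](_ : _ =
  16 * C ^+ 4 * (n%:R ^+ 2 * q ^+ 4) / (2 ^ J)%:R); last first.
  by field; exact: lt0r_neq0.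
rewrite ler_pdivrMr//.
rewrite [leRHS](_ : _ = 16 * C ^+ 4 * (2 * w ^+ 4 * (2 ^ J)%:R)); last by ring.
by rewrite ler_wpM2l// mulr_ge0// exprn_ge0// ltW.
Qed.

End rates.

(** * The lower bound *)

Section lower_bound.
Context {R : realType}.
Variable psi : nat -> nat -> R -> R.
Hypothesis hpsi : orthonormal_basis psi.
Variables (s t rad eta C : R).
Hypotheses (t0 : 0 < t) (ts : t < s) (rad0 : 0 < rad) (eta0 : 0 < eta)
  (eta1 : eta < 1).
Hypothesis CE : C = rad / 2 * Num.min 1
  (Num.sqrt (ln (1 + 4 * (1 - eta) ^+ 2)) / (2 `^ t * 16 * rad)).

Let b := 4 * (1 - eta) ^+ 2.
Let b0 : 0 < b. Proof. by rewrite mulr_gt0// exprn_gt0// subr_gt0. Qed.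
Let L := ln (1 + b).
Let L0 : 0 < L. Proof. by rewrite ln_gt0// ltrDl. Qed.

Lemma separation_constant_gt0 : 0 < C.
Proof.
rewrite CE mulr_gt0 ?divr_gt0// lt_min ltr01/= divr_gt0 ?sqrtr_gt0//.
by rewrite !mulr_gt0// powR_gt0.
Qed.
Let C0 := separation_constant_gt0.

Lemma separation_constant_le_radius : 2 * C <= rad.
Proof.
rewrite CE mulrA (mulrC 2) divfK// -[leRHS]mulr1 ler_pM2l//.
by rewrite ge_min lexx.
Qed.

(** The second term of the minimum gives 2 C 2^t <= sqrt L / 16; the weaker
    bound by sqrt L / 4 is enough. *)
Lemma separation_constant_le_budget : 2 * (2 * C * 2 `^ t) ^+ 4 <= L ^+ 2 / 32.
Proof.
have w0 : 0 < 2 `^ t :> R by rewrite powR_gt0.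
have le1 : 2 * C * 2 `^ t <= Num.sqrt L / 4.
  have : C <= rad / 2 * (Num.sqrt L / (2 `^ t * 16 * rad)).
    by rewrite CE ler_pM2l ?divr_gt0// ge_min lexx orbT.
  rewrite (_ : rad / 2 * _ = Num.sqrt L / (32 * 2 `^ t)); last first.
    by field; rewrite !lt0r_neq0.
  rewrite ler_pdivlMr ?mulr_gt0// => h.
  have sL : 0 <= Num.sqrt L by exact: sqrtr_ge0.
  by lra.
have x0 : 0 <= 2 * C * 2 `^ t by rewrite !mulr_ge0// ltW.
have : (2 * C * 2 `^ t) ^+ 4 <= (Num.sqrt L / 4) ^+ 4.
  by rewrite lerXn2r ?nnegrE// divr_ge0// sqrtr_ge0.
have -> : (Num.sqrt L / 4) ^+ 4 = (Num.sqrt L ^+ 2) ^+ 2 / 256 by field.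
rewrite sqr_sqrtr; last exact: ltW.
have := sqr_ge0 L; lra.
Qed.

Variables (n : nat) (P : (R -> R) -> probability (observation R) R).
Hypothesis wn : white_noise_model psi n P.
Local Notation beta := (2 * t + 1 / 2).
Hypothesis nN :
  (rad * (2 `^ (s - t) / C)) `^ (beta / (s - t)) <= n%:R.
Hypothesis J2 : (2 <= Num.floor (1 / beta * (ln n%:R / ln 2)))%R.

Lemma total_error_gt (rho : R) (phi : {mfun observation R >-> bool}) :
  0 < rho -> rho <= C * n%:R `^ (- (t / beta)) ->
  eta < total_error P (besov_ball psi s rad)
    (separated_ball psi s t rad rho) phi.
Proof.
move=> rho0 rhoC.
have beta0 : 0 < beta by move: t0; lra.
have ln20 : 0 < ln 2 :> R by rewrite ln_gt0// ltr1n.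
have n0 : (0 < n)%N.
  (* ln 0 = 0, so that n = 0 would give the level 0 *)
  by case: (n) J2 => //; rewrite ln0// mul0r mulr0 floor0.
pose x := 1 / beta * (ln n%:R / ln 2).
have J2x : (2 <= Num.floor x)%R := J2.
pose J := `|Num.floor x|%N.
have JE : Num.floor x = J%:Z by rewrite /J gez0_abs// (le_trans _ J2x).
have J2' : (2 <= J)%N by rewrite -lez_nat -JE.
have xE : x = ln n%:R / (beta * ln 2).
  by rewrite /x div1r invfM mulrCA.
have Jle : J%:R * beta * ln 2 <= ln n%:R.
  rewrite -mulrA -ler_pdivlMr ?mulr_gt0// -xE.
  by have := floor_le x; rewrite JE.
have Jgt : ln n%:R < (J%:R + 1) * beta * ln 2.
  rewrite -mulrA -ltr_pdivrMr ?mulr_gt0// -xE.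
  by have := floorD1_gt x; rewrite JE intrD.
pose m := (2 ^ J)%N.
have m0 : 0 < m%:R :> R by rewrite ltr0n expn_gt0.
(* D is the norm of the alternatives, h bounds the level-J norm of the elements
   of the s-ball. *)
pose D := 2 * C * 2 `^ (- (t * J%:R)).
pose h := rad * 2 `^ (- (s * J%:R)).
have D0 : 0 < D by rewrite !mulr_gt0// powR_gt0.
have h0 : 0 < h by rewrite mulr_gt0// powR_gt0.
have rho_lt : rho < D - h.
  have hC := smooth_bias_lt t0 ts rad0 C0 n0 Jgt nN.
  apply: (@le_lt_trans _ _ (C * 2 `^ (- (t * J%:R)))).
    apply: (le_trans rhoC); rewrite ler_pM2l//.
    exact: (rate_le_level t0 n0 Jle).
  rewrite /D /h; move: hC; lra.
pose alpha := D / Num.sqrt m%:R.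
have alpha2 : alpha ^+ 2 = D ^+ 2 / m%:R.
  by rewrite expr_div_n sqr_sqrtr// ltW.
have malpha (xi : {ffun 'I_m -> bool}) :
    \sum_(k < m) sign_coef alpha xi k ^+ 2 = D ^+ 2.
  by rewrite sum_sign_coef alpha2 mulrC divfK// lt0r_neq0.
have null_ball : besov_ball psi s rad (fun=> 0).
  split; first exact: L2_0.
  have -> : (fun=> 0) = level_fun psi (fun _ : 'I_m => 0 : R).
    by apply/funext => z; rewrite /level_fun big1// => k _; rewrite mul0r.
  apply: (besov_norm_level_fun hpsi J2'); first exact: ltW.
  by rewrite big1 ?mulr0 ?sqr_ge0// => k _; rewrite expr0n.
have alt_ball (xi : {ffun 'I_m -> bool}) :
    separated_ball psi s t rad rho (sign_fun psi alpha xi).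
  split.
    split; first exact: (L2_level_fun hpsi J2' (sign_coef alpha xi)).
    apply: (besov_norm_level_fun hpsi J2' (c := sign_coef alpha xi)).
      exact: ltW.
    rewrite malpha besov_weight lerXn2r ?separation_constant_le_radius//.
      by rewrite nnegrE ltW// mulr_gt0.
    by rewrite nnegrE ltW.
  apply: (@lt_le_trans _ _ (D - h)%:E); first by rewrite lte_fin.
  apply/ereal_infP => _ [g gball <-].
  apply: (level_fun_separated hpsi J2' rad0 D0 h0 gball (malpha xi)).
  by rewrite besov_weight.
have mphi (c : bool) : measurable (phi @^-1` [set c]).
  by rewrite -[X in measurable X]setTI; exact: measurable_funP.
pose A := phi @^-1` [set true].
have mA : measurable A by exact: mphi.
have Ac : phi @^-1` [set false] = ~` A.
  by apply/seteqP; split=> a; rewrite /A /=; case: (phi a).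
have budget :
    ((expR (n%:R * alpha ^+ 2) + expR (- (n%:R * alpha ^+ 2))) / 2) ^+ m <
    1 + 4 * (1 - eta) ^+ 2.
  apply: chi_square_budget; rewrite ?expn_gt0//.
    have : 0 < 1 - eta <= 1 by rewrite subr_gt0 eta1 lerBlDr lerDl ltW.
    by move=> /andP[]; nra.
  rewrite alpha2; apply: le_trans separation_constant_le_budget.
  exact: (level_separation_budget C0 n0 Jgt).
have [xi] := sign_fun_indistinguishable hpsi J2' wn n0 eta1 mA budget.
have pfin f : P f A \is a fin_num by exact: fin_num_measure.
rewrite -(fineK (pfin _)) -(fineK (pfin (fun=> 0))) -EFinD lte_fin => close.
have bounded (H : set (R -> R)) (c : bool) :
    has_ubound [set fine (P f (phi @^-1` [set c])) | f in H].
  exists 1 => _ [f _ <-]; rewrite -lee_fin fineK.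
    by apply: probability_le1; exact: mphi.
  by apply: fin_num_measure; exact: mphi.
have S0 : fine (P (fun=> 0) A) <=
    sup [set fine (P f (phi @^-1` [set true])) | f in besov_ball psi s rad].
  by apply: ub_le_sup; [exact: bounded|exists (fun=> 0)].
have S1 : 1 - fine (P (sign_fun psi alpha xi) A) <=
    sup [set fine (P f (phi @^-1` [set false])) |
      f in separated_ball psi s t rad rho].
  apply: ub_le_sup; first exact: bounded.
  exists (sign_fun psi alpha xi); first exact: alt_ball.
  by rewrite Ac probability_setC// fineB.
rewrite /total_error; move: S0 S1 close; lra.
Qed.

End lower_bound.

Theorem theorem3p2 (R : realType) (psi : nat -> nat -> R -> R)
    (hpsi : orthonormal_basis psi) (s t rad eta : R)
    (ht : 0 < t) (hst : t < s) (hrad : 0 < rad) (heta0 : 0 < eta)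
    (heta1 : eta < 1) :
  exists (C : R) (N : nat),
  [/\ 0 < C,
      C = rad / 2 * Num.min 1
            (Num.sqrt (ln (1 + 4 * (1 - eta) ^+ 2)) / (2 `^ t * 16 * rad)),
      N%:Z = Num.ceil ((rad * (2 `^ (s - t) / C)) `^ ((2 * t + 1 / 2) / (s - t)))
    & forall (n : nat) (P : (R -> R) -> probability (observation R) R),
        white_noise_model psi n P -> (N <= n)%N ->
        (2 <= Num.floor (1 / (2 * t + 1 / 2) * (ln n%:R / ln 2)))%R ->
        (forall rho : R, 0 < rho ->
           rho <= C * n%:R `^ (- (t / (2 * t + 1 / 2))) ->
           forall phi : {mfun observation R >-> bool},
             eta < total_error P (besov_ball psi s rad)
                     (separated_ball psi s t rad rho) phi) /\
        ((C * n%:R `^ (- (t / (2 * t + 1 / 2))))%:E <=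
           separation_distance psi P s t rad eta)%E].
Proof.
pose C := rad / 2 * Num.min 1
  (Num.sqrt (ln (1 + 4 * (1 - eta) ^+ 2)) / (2 `^ t * 16 * rad)).
have CE : C = rad / 2 * Num.min 1
  (Num.sqrt (ln (1 + 4 * (1 - eta) ^+ 2)) / (2 `^ t * 16 * rad)) by [].
pose Z := (rad * (2 `^ (s - t) / C)) `^ ((2 * t + 1 / 2) / (s - t)).
have ceilZ : `|Num.ceil Z|%N%:Z = Num.ceil Z.
  by rewrite gez0_abs// ceil_ge0 (lt_le_trans _ (powR_ge0 _ _))// ltrN10.
exists C, `|Num.ceil Z|%N; split=> //.
  exact: (separation_constant_gt0 hrad heta1 CE).
move=> n P wn Nn J2.
have nN : Z <= n%:R.
  apply: (le_trans (ceil_ge Z)); rewrite -ceilZ -[n%:R]/(n%:Z%:~R).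
  by rewrite ler_int lez_nat.
have error_gt rho : 0 < rho -> rho <= C * n%:R `^ (- (t / (2 * t + 1 / 2))) ->
    forall phi : {mfun observation R >-> bool},
      eta < total_error P (besov_ball psi s rad)
              (separated_ball psi s t rad rho) phi.
  move=> rho0 rhoC phi.
  exact: (total_error_gt hpsi ht hst hrad heta0 heta1 CE wn nN J2).
split=> //; apply/ereal_infP => _ [rho [rho0 [phi phi_le]] <-].
rewrite lee_fin leNgt; apply/negP => /ltW rhoC.
by have := error_gt rho rho0 rhoC phi; rewrite ltNge phi_le.
Qed.
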